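(* Let $F$ be a finite field with $q$ elements and $G$ a finite abelian group of order $m$. Let $r\in(0,1)$ and $\delta\in(0,1-q^{-1})$. For each positive integer $n$ put $k=[rn]$ (the integer nearest to $rn$), let $A$ be chosen uniformly at random from $(FG)^{k\times n}$, and let $$\hat{\mathcal N}_{C_A}(\delta)=\big|\{\mathbf{b}\in(FG)^k \mid 1\le \mathrm{w}(\mathbf{b}A)\le mn\delta\}\big|.$$ Then $$\lim_{n\to\infty}\mathrm{E}\big(\hat{\mathcal N}_{C_A}(\delta)\big)=\begin{cases}0,& r<g_q(\delta),\\ \infty,& r>g_q(\delta),\end{cases}$$ and both limits converge exponentially.
   Context: $FG$ is the group algebra. Each element $\sum_{z\in G}a_z z$ of $FG$ is identified with the word $(a_z)_{z\in G}\in F^m$, and elements of $(FG)^n$ with concatenated words of length $mn$; $\mathrm{w}$ denotes Hamming weight. For $\mathbf{b}=(b_1,\dots,b_k)\in(FG)^k$ and $A=(a_{ij})$, $\mathbf{b}A=(\sum_i b_ia_{i1},\dots,\sum_i b_ia_{in})\in(FG)^n$. The $q$-ary entropy is $h_q(x)=x\log_q(q-1)-x\log_q x-(1-x)\log_q(1-x)$ (with $0\log_q0=0$) and $g_q(x)=1-h_q(x)$. *)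

(* Defs.v *)
From HB Require Import structures.
From mathcomp Require Import all_boot all_order all_algebra all_fingroup.
From mathcomp Require Import all_classical all_reals all_analysis.
Set Implicit Arguments. Unset Strict Implicit. Unset Printing Implicit Defensive.
Import Order.TTheory GRing.Theory Num.Theory.
Local Open Scope ring_scope.

(* Group algebra FG: an element sum_z a_z z is identified with the word
   (a_z)_{z in G}, i.e. a finite function G -> F. *)
Definition galg (F : finFieldType) (gT : finGroupType) := {ffun gT -> F}.

Definition galg_mul (F : finFieldType) (gT : finGroupType)
  (a b : galg F gT) : galg F gT :=
  [ffun z => \sum_(x : gT) a x * b (x^-1 * z)%g].

Definition galg_add (F : finFieldType) (gT : finGroupType)
  (a b : galg F gT) : galg F gT := [ffun z => a z + b z].

Definition galg_zero (F : finFieldType) (gT : finGroupType) : galg F gT :=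
  [ffun => 0].

Definition galg_wt (F : finFieldType) (gT : finGroupType) (a : galg F gT) : nat :=
  #|[set z : gT | a z != 0]|.

Definition vecmat (F : finFieldType) (gT : finGroupType) (k n : nat)
  (b : {ffun 'I_k -> galg F gT}) (A : {ffun 'I_k * 'I_n -> galg F gT})
  : {ffun 'I_n -> galg F gT} :=
  [ffun j => \big[@galg_add F gT/galg_zero F gT]_(i < k) galg_mul (b i) (A (i, j))].

Definition vec_wt (F : finFieldType) (gT : finGroupType) (n : nat)
  (v : {ffun 'I_n -> galg F gT}) : nat :=
  \sum_(j < n) galg_wt (v j).

Definition Nhat (R : realType) (F : finFieldType) (gT : finGroupType) (k n : nat)
  (delta : R) (A : {ffun 'I_k * 'I_n -> galg F gT}) : nat :=
  #|[set b : {ffun 'I_k -> galg F gT} |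
      (1 <= vec_wt (vecmat b A))%N &&
      ((vec_wt (vecmat b A))%:R <= (#|gT| * n)%:R * delta)]|.

(* k = [r n], the integer nearest to r n (ties rounded up) *)
Definition kround (R : realType) (r : R) (n : nat) : nat :=
  Num.truncn (r * n%:R + 2^-1).

Definition ENhat (R : realType) (F : finFieldType) (gT : finGroupType)
  (r delta : R) (n : nat) : R :=
  (\sum_(A : {ffun 'I_(kround r n) * 'I_n -> galg F gT})
      (Nhat delta A)%:R)
  / (#|{ffun 'I_(kround r n) * 'I_n -> galg F gT}|)%:R.

(* q-ary entropy, with 0 log 0 = 0 *)
Definition logq (R : realType) (q : nat) (x : R) : R := ln x / ln q%:R.

Definition hq (R : realType) (q : nat) (x : R) : R :=
  x * logq q (q%:R - 1)
  - (if x == 0 then 0 else x * logq q x)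
  - (if x == 1 then 0 else (1 - x) * logq q (1 - x)).

Definition gq (R : realType) (q : nat) (x : R) : R := 1 - hq q x.

(* Main.v *)
(* For fixed [b], the product [bA] of a uniform [A] is uniform on [I^n], where
   [I] is the right ideal generated by the entries of [b].

   If [r < g_q(delta)]: [I] is translation invariant and has an information set
   [S] with [#|I| = q ^ #|S|].  Put [t = delta / ((1 - delta) (q - 1)) < 1].
   AM-GM over the translates of [S] bounds the weight enumerator of [I] at
   [t ^ (#|S| / m)] by [(1 + (q - 1) t) ^ #|S|], and Chernoff's bound then gives
   [P(1 <= w(bA) <= m n delta) <= #|I| ^ (- n g_q(delta))].  At most [#|I| ^ k]
   vectors [b] generate [I], and the number of ideals does not depend on [n].

   If [r > g_q(delta)]: the vectors [b] with first entry [1] make [bA] uniform on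
   [(FG)^n] and form a fraction [q ^ (- m)] of [(FG)^k]; the sphere of radius
   [floor(m n delta)] has [q ^ (m n h_q(delta))] elements up to a linear factor
   in [n], because the binomial distribution peaks at its mean. *)

Require Import Defs.
From HB Require Import structures.
From mathcomp Require Import all_boot all_order all_algebra all_fingroup.
From mathcomp Require Import all_classical all_reals all_analysis.
From mathcomp Require Import ring lra zify.
Import Order.TTheory GRing.Theory Num.Theory.
Set Implicit Arguments. Unset Strict Implicit. Unset Printing Implicit Defensive.
Local Open Scope ring_scope.

(** * Averages over the image of an additive map *)

HB.instance Definition _ (T : finType) (V : finZmodType) :=
  GRing.Zmodule.on {ffun T -> V}.

(** The fibres of [phi] are cosets of its kernel, hence equally large. The proof bypasses the
    kernel: translating [f] by an element of the image leaves the left sum unchanged, so one sums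
    over these translates and exchanges the sums. *)
Lemma sum_additive_image (R : pzRingType) (U V : finZmodType) (phi : U -> V)
    (f : V -> R) : {morph phi : x y / x + y} ->
  #|phi @: U|%:R * (\sum_u f (phi u)) = #|U|%:R * \sum_(v in phi @: U) f v.
Proof.
move=> phiD.
have phi0 : phi 0 = 0 by apply: (addrI (phi 0)); rewrite -phiD !addr0.
have phiN x : phi (- x) = - phi x.
  by apply: (addrI (phi x)); rewrite -phiD !subrr phi0.
have shift v : v \in phi @: U -> \sum_u f (phi u) = \sum_u f (phi u + v).
  move=> /imsetP[w _ ->]; rewrite (reindex_inj (addIr w)).
  by apply: eq_bigr => u _; rewrite phiD.
have -> : #|phi @: U|%:R * (\sum_u f (phi u)) =
    \sum_(v in phi @: U) \sum_u f (phi u + v).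
  rewrite [RHS](eq_bigr (fun=> \sum_u f (phi u))) => [|v vI].
    by rewrite sumr_const mulr_natl.
  by rewrite -shift.
rewrite exchange_big /=.
rewrite (eq_bigr (fun=> \sum_(v in phi @: U) f v)) => [|u _].
  by rewrite sumr_const mulr_natl.
rewrite [RHS](reindex_inj (addrI (phi u))) /=.
apply: eq_bigl => v; apply/imsetP/imsetP => -[w _].
  by move=> ->; exists (u + w); rewrite ?phiD.
move=> e; exists (w - u) => //.
by rewrite phiD phiN -e addrAC subrr add0r.
Qed.

(** * Weight enumerators and information sets of linear codes *)

Section FfunWeight.
Variables (F : finFieldType) (T : finType).
Implicit Types f c : {ffun T -> F}.

Definition ffun_wt f : nat := #|[set z | f z != 0]|.

Lemma ffun_wt_sum f : ffun_wt f = (\sum_z (f z != 0%R))%N.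
Proof.
rewrite /ffun_wt -sum1_card big_mkcond; apply: eq_bigr => z _.
by rewrite inE; case: eqP.
Qed.

Lemma sum_ffun_wt (R : comNzRingType) (x : R) :
  \sum_(f : {ffun T -> F}) x ^+ ffun_wt f = (1 + (#|F|%:R - 1) * x) ^+ #|T|.
Proof.
have -> : 1 + (#|F|%:R - 1) * x = \sum_(y : F) x ^+ (y != 0).
  rewrite (bigD1 0) //= eqxx expr0; congr (_ + _).
  rewrite (eq_bigr (fun=> x)) => [|y ->//].
  rewrite sumr_const -[x *+ _]mulr_natl; congr (_ * _).
  rewrite [in LHS](cardD1 (0 : F)) natrD addrAC subrr add0r; congr (_%:R).
  by apply: eq_card => y; rewrite !inE andbT.
rewrite -prodr_const bigA_distr_bigA /=.
by apply: eq_bigr => f _; rewrite ffun_wt_sum prodrXr.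
Qed.

Definition ffun_res (S : {set T}) c : {ffun {z | z \in S} -> F} :=
  [ffun z => c (val z)].

(** Take [S] minimal such that only the zero word of [I] vanishes on [S]. This makes restriction to
    [S] injective on [I], and minimality makes it onto. *)
Lemma information_set (I : {set {ffun T -> F}}) : 0 \in I ->
  {in I &, forall c d, c + d \in I} ->
  {in I, forall c a, [ffun z => a * c z] \in I} ->
  exists2 S : {set T}, {in I &, injective (ffun_res S)} & #|I| = (#|F| ^ #|S|)%N.
Proof.
move=> I0 ID IZ.
pose P (S : {set T}) := [forall c in I, [forall z in S, c z == 0] ==> (c == 0)].
have PT : P [set: T].
  apply/forall_inP => c cI; apply/implyP => /forall_inP h.
  by apply/eqP/ffunP => z; rewrite ffunE; apply/eqP/h; rewrite inE.
have [S /minsetP[PS minS] _] := minset_exists PT.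
have IN : {in I, forall c, - c \in I}.
  move=> c cI; suff -> : - c = [ffun z => -1 * c z] by exact: IZ.
  by apply/ffunP => z; rewrite !ffunE mulN1r.
have injS : {in I &, injective (ffun_res S)}.
  move=> c d cI dI cd; apply/eqP; rewrite -subr_eq0.
  move/forall_inP: PS => /(_ _ (ID _ _ cI (IN _ dI)))/implyP; apply.
  apply/forall_inP => z zS; rewrite !ffunE subr_eq0; apply/eqP.
  by have /ffunP/(_ (exist _ z zS)) := cd; rewrite !ffunE.
exists S => //.
(* Dropping [s] from [S] destroys [P], so some word of [I] vanishes on the rest of [S] but not at
   [s]. Scaled to 1 at [s], these words form a dual basis, by which every function on [S] is
   interpolated. *)
have E (s : {z | z \in S}) : exists2 e, e \in I &
    forall z : {z | z \in S}, e (val z) = (z == s)%:R.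
  have : ~~ P (S :\ val s).
    apply/negP => /minS; rewrite subD1set => /(_ isT) e.
    by have /setP/(_ (val s)) := e; rewrite !inE eqxx (valP s).
  rewrite negb_forall => /existsP[c]; rewrite negb_imply => /andP[cI].
  rewrite negb_imply => /andP[/forall_inP c0 cN0].
  have cs : c (val s) != 0.
    apply: contra cN0 => cs0; move/forall_inP: PS => /(_ _ cI)/implyP; apply.
    apply/forall_inP => z zS; have [->//|zs] := eqVneq z (val s).
    by apply: c0; rewrite !inE zs.
  exists [ffun z => (c (val s))^-1 * c z]; first exact: IZ.
  move=> z; rewrite ffunE; have [->|zs] := eqVneq z s; first by rewrite mulVf.
  have /eqP -> : c (val z) == 0 by apply: c0; rewrite !inE val_eqE zs (valP z).
  by rewrite mulr0.
have card_sub : #|{: {z | z \in S}}| = #|S| by rewrite card_sig.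
rewrite -card_sub -card_ffun -(card_in_imset injS).
apply: eq_card => f; rewrite [RHS]inE; apply/imsetP.
pose e s := s2val (cid2 (E s)).
have eI s : e s \in I by rewrite /e; case: cid2.
have eE s z : e s (val z) = (z == s)%:R by rewrite /e; case: cid2.
exists (\sum_s [ffun z => f s * e s z]).
  by apply: (big_ind (fun c => c \in I)) => [||s _]; [|exact: ID|exact: IZ].
apply/ffunP => z; rewrite ffunE sum_ffunE (bigD1 z) //= ffunE eE eqxx mulr1.
rewrite big1 ?addr0// => s sz.
by rewrite ffunE eE eq_sym (negbTE sz) mulr0.
Qed.

End FfunWeight.

(** * Right ideals of the group algebra and the distribution of $bA$ *)

Section GroupAlgebra.
Variables (F : finFieldType) (gT : finGroupType).
Local Notation FG := {ffun gT -> F}.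

Lemma galg_mulDr (a b c : FG) :
  galg_mul a (b + c) = galg_mul a b + galg_mul a c.
Proof.
apply/ffunP => z; rewrite !ffunE -big_split; apply: eq_bigr => x _.
by rewrite ffunE mulrDr.
Qed.

Lemma galg_add_big (J : Type) (s : seq J) (f : J -> FG) :
  \big[@galg_add F gT/galg_zero F gT]_(i <- s) f i = \sum_(i <- s) f i.
Proof.
elim: s => [|i s IH].
  by rewrite !big_nil; apply/ffunP => z; rewrite !ffunE.
by rewrite !big_cons IH; apply/ffunP => z; rewrite !ffunE.
Qed.

Variable k : nat.
Implicit Types b : {ffun 'I_k -> FG}.

Definition lcomb b (a : {ffun 'I_k -> FG}) : FG :=
  \sum_(i < k) galg_mul (b i) (a i).

(** The right ideal generated by the entries of [b]; [lcomb b] sends a column of $A$ to the matching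
    entry of $bA$. *)
Definition ideal_of b : {set FG} := lcomb b @: {ffun 'I_k -> FG}.

Lemma vecmatE n b (A : {ffun 'I_k * 'I_n -> galg F gT}) j :
  vecmat b A j = lcomb b [ffun i => A (i, j)].
Proof.
by rewrite ffunE galg_add_big; apply: eq_bigr => i _; rewrite ffunE.
Qed.

Lemma lcombD b : {morph lcomb b : x y / x + y}.
Proof.
move=> x y; rewrite /lcomb -big_split; apply: eq_bigr => i _.
by rewrite ffunE galg_mulDr.
Qed.

Lemma vecmatD n b :
  {morph (@vecmat F gT k n b : {ffun 'I_k * 'I_n -> FG} -> {ffun 'I_n -> FG})
    : A B / A + B}.
Proof.
move=> A B; apply/ffunP => j; rewrite vecmatE ffunE !vecmatE -lcombD.
by congr lcomb; apply/ffunP => i; rewrite !ffunE.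
Qed.

Lemma vecmat_image n b :
  (@vecmat F gT k n b : {ffun 'I_k * 'I_n -> FG} -> {ffun 'I_n -> FG}) @:
    {ffun 'I_k * 'I_n -> FG} =i ffun_on (ideal_of b).
Proof.
move=> v; apply/imsetP/ffun_onP => [[A _ -> j]|vI].
  by rewrite vecmatE imset_f.
have aP j : {a | v j = lcomb b a}.
  by apply: cid; have /imsetP[a _ ->] := vI j; exists a.
exists [ffun p : 'I_k * 'I_n => sval (aP p.2) p.1] => //.
apply/ffunP => j; rewrite vecmatE (svalP (aP j)); congr lcomb.
by apply/ffunP => i; rewrite !ffunE.
Qed.

(** Uniformity of $bA$ on $I^n$, as an equality of means with denominators cleared: the columns of
    $A$ vary independently, so the image of $A \mapsto bA$ is all of $I^n$. *)
Lemma sum_vecmat (R : pzRingType) n b (f : {ffun 'I_n -> FG} -> R) :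
  #|ideal_of b|%:R ^+ n * (\sum_(A : {ffun 'I_k * 'I_n -> FG}) f (vecmat b A)) =
  #|{: {ffun 'I_k * 'I_n -> FG}}|%:R *
    \sum_(v in ffun_on (ideal_of b)) f v.
Proof.
rewrite -natrX -{1}(card_ord n) -card_ffun_on -(eq_card (vecmat_image b)).
rewrite (sum_additive_image f (@vecmatD n b)); congr (_ * _).
by apply: eq_bigl => v; rewrite vecmat_image.
Qed.

Lemma ideal0 b : 0 \in ideal_of b.
Proof.
apply/imsetP; exists 0 => //; apply: (addrI (lcomb b 0)).
by rewrite -lcombD !addr0.
Qed.

Lemma idealD b : {in ideal_of b &, forall c d, c + d \in ideal_of b}.
Proof.
by move=> _ _ /imsetP[x _ ->] /imsetP[y _ ->]; rewrite -lcombD imset_f.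
Qed.

Lemma idealZ b :
  {in ideal_of b, forall (c : FG) a, [ffun z => a * c z] \in ideal_of b}.
Proof.
move=> _ /imsetP[x _ ->] a; apply/imsetP.
exists [ffun i => [ffun z => a * x i z]] => //.
apply/ffunP => z; rewrite /lcomb ffunE !sum_ffunE mulr_sumr.
apply: eq_bigr => i _; rewrite !ffunE mulr_sumr; apply: eq_bigr => y _.
by rewrite !ffunE mulrCA.
Qed.

(** Right multiplication by the group element [y^-1], which preserves right ideals. *)
Definition translate (y : gT) (c : FG) : FG := [ffun z => c (z * y)%g].

Lemma ideal_translate b y : {in ideal_of b, forall c, translate y c \in ideal_of b}.
Proof.
move=> _ /imsetP[x _ ->]; apply/imsetP.
exists [ffun i => translate y (x i)] => //.
apply/ffunP => z; rewrite /lcomb ffunE !sum_ffunE.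
apply: eq_bigr => i _; rewrite !ffunE; apply: eq_bigr => w _.
by rewrite !ffunE mulgA.
Qed.

Lemma mem_ideal b i : b i \in ideal_of b.
Proof.
apply/imsetP; exists [ffun j => [ffun z => ((j == i) && (z == 1%g))%:R]] => //.
apply/ffunP => z; rewrite /lcomb sum_ffunE (bigD1 i) //=.
rewrite [X in _ + X]big1 ?addr0 => [|j ji]; last first.
  by rewrite [LHS]ffunE big1 // => x _; rewrite !ffunE (negbTE ji) mulr0.
rewrite [RHS]ffunE (bigD1 z) //= !ffunE eqxx mulVg eqxx mulr1 big1 ?addr0 // => x xz.
by rewrite !ffunE /= -eq_mulVg1 (negbTE xz) mulr0.
Qed.

(** The function in the hypothesis is the identity of $FG$. *)
Lemma idealT b i : b i = [ffun z => (z == 1%g)%:R] -> ideal_of b = [set: FG].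
Proof.
move=> bi; apply/setP => c; rewrite finset.in_setT; apply/imsetP.
exists [ffun j => [ffun z => if j == i then c z else 0]] => //.
apply/ffunP => z; rewrite /lcomb sum_ffunE (bigD1 i) //= bi.
rewrite [X in _ + X]big1 ?addr0 => [|j ji]; last first.
  by rewrite [LHS]ffunE big1 // => x _; rewrite !ffunE (negbTE ji) mulr0.
rewrite [RHS]ffunE (bigD1 1%g) //= !ffunE !eqxx invg1 !mul1g mul1r big1 ?addr0 // => x x1.
by rewrite !ffunE (negbTE x1) mul0r.
Qed.

(** Double counting: for each fixed [z] in [S], the product [z * y] runs through the whole group
    with [y] and so meets every nonzero coordinate of [c] once. *)
Lemma sum_wt_translate (S : {set gT}) (c : FG) :
  (\sum_y ffun_wt (ffun_res S (translate y c)) = #|S| * galg_wt c)%N.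
Proof.
under eq_bigr do rewrite ffun_wt_sum.
rewrite exchange_big /= (eq_bigr (fun=> galg_wt c)) => [|z _].
  by rewrite sum_nat_const card_sig.
rewrite -[galg_wt c]/(ffun_wt c) ffun_wt_sum [RHS](reindex_inj (mulgI (val z))).
by apply: eq_bigr => y _; rewrite !ffunE.
Qed.

Lemma sum_vec_wt (R : comNzRingType) n (x : R) (I : {set FG}) :
  \sum_(v in ffun_on I) x ^+ vec_wt (v : {ffun 'I_n -> FG}) =
  (\sum_(c in I) x ^+ galg_wt c) ^+ n.
Proof.
rewrite -[n in RHS]card_ord -prodr_const.
rewrite (bigA_distr_big (fun c => c \in I)
  (fun (_ : 'I_n) (c : FG) => x ^+ galg_wt c)) /=.
by apply: eq_bigr => v _; rewrite /vec_wt prodrXr.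
Qed.

(** Both sides are the coefficient of $X^w$ in $(1+(q-1)X)^{mn}$, the weight enumerator of
    $(FG)^n$. *)
Lemma card_vec_wt n w :
  #|[set v : {ffun 'I_n -> FG} | vec_wt v == w]| =
  ('C(#|gT| * n, w) * (#|F| - 1) ^ w)%N.
Proof.
have := @sum_vec_wt {poly int} n 'X [set: FG].
rewrite (eq_bigl predT) => [|v]; last first.
  by rewrite [RHS]inE; apply/ffun_onP => i; rewrite finset.in_setT.
rewrite [X in _ = X ^+ _](eq_bigl predT) => [|c]; last by rewrite finset.in_setT.
rewrite [X in _ = X ^+ _](@sum_ffun_wt F gT) -exprM => /(congr1 (coefp w)) /=.
have q0 : (0 < #|F|)%N by apply/card_gt0P; exists 0.
rewrite coef_sum addrC exprD1n coef_sum /=.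
have -> : (#|F|%:R - 1) = ((#|F| - 1)%:R)%:P :> {poly int}.
  by rewrite natrB // polyCB -polyC_natr.
under [RHS]eq_bigr do rewrite exprMn -polyC_exp coefMn coefCM coefXn.
move=> e.
apply/eqP; rewrite -(eqr_nat int); apply/eqP.
transitivity (\sum_(v : {ffun 'I_n -> FG}) ('X^(vec_wt v) : {poly int})`_w).
  rewrite -sum1_card natr_sum big_mkcond /=; apply: eq_bigr => v _.
  by rewrite inE coefXn eq_sym; case: eqP.
rewrite e.
have [wN|Nw] := ltnP w (#|gT| * n).+1.
  rewrite (bigD1 (Ordinal wN)) //= eqxx mulr1 big1 ?addr0 => [|i iw].
    by rewrite natrM natrX mulr_natl.
  have : (w == i) = false.
    by apply/negbTE; rewrite eq_sym; apply: contra iw => /eqP iw; apply/eqP/val_inj.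
  by move=> ->; rewrite mulr0 mul0rn.
rewrite bin_small // mul0n big1 // => i _.
have -> : (w == i) = false.
  by apply/negbTE; rewrite neq_ltn (leq_trans (ltn_ord i) Nw) orbT.
by rewrite mulr0 mul0rn.
Qed.

End GroupAlgebra.

(** * The Chernoff parameter and its relation to the entropy *)

Section Tilt.
Variable R : realType.

(** The parameter $t$ for which a symbol drawn with probability proportional to $t^{\mathrm{wt}}$ is
    nonzero with probability [delta]. *)
Definition tilt (q : nat) (delta : R) : R := delta / ((1 - delta) * (q%:R - 1)).

Variables (q : nat) (delta : R).
Hypotheses (q1 : (1 < q)%N) (hdelta : 0 < delta < 1 - q%:R^-1).

Let qR : 1 < q%:R :> R. Proof. by rewrite ltr1n. Qed.

Let delta1 : delta < 1.
Proof.
have iq : 0 < q%:R^-1 :> R by rewrite invr_gt0; move: qR; lra.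
by move: hdelta; lra.
Qed.

Lemma tilt_gt0 : 0 < tilt q delta.
Proof. by rewrite divr_gt0 ?mulr_gt0; move: hdelta delta1 qR; lra. Qed.

(** Clearing denominators turns this into [delta < 1 - q^-1]. It makes $\ln t$ negative, so that
    tilting favours low weights. *)
Lemma tilt_lt1 : tilt q delta < 1.
Proof.
have q1R := qR.
rewrite ltr_pdivrMr; last by rewrite mulr_gt0 ?subr_gt0 ?delta1.
rewrite mul1r; have /andP[_] := hdelta.
rewrite -(ltr_pM2r (_ : 0 < q%:R)); last lra.
by rewrite mulrBl mul1r mulVf; lra.
Qed.

Lemma tilt_sum : 1 + (q%:R - 1) * tilt q delta = (1 - delta)^-1.
Proof. by rewrite /tilt; field; apply/andP; split; move: delta1 qR; lra. Qed.

(** In multiplicative form $q^{h_q(\delta)} = (1+(q-1)t)\,t^{-\delta}$: the entropy is the Chernoff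
    exponent at $t$. *)
Lemma hq_tilt :
  ln q%:R * hq q delta = - delta * ln (tilt q delta) - ln (1 - delta).
Proof.
have lnq : ln q%:R != 0 :> R by rewrite gt_eqF// ln_gt0.
have [d0 _] := andP hdelta.
rewrite /hq /logq gt_eqF// lt_eqF// /tilt.
rewrite !lnM ?lnV ?lnM ?posrE ?invr_gt0 ?mulr_gt0 ?subr_gt0 //.
by field.
Qed.

End Tilt.

Lemma card_field_gt1 (F : finFieldType) : (1 < #|F|)%N.
Proof. by apply/card_gt1P; exists 0, 1; split; rewrite // eq_sym oner_neq0. Qed.

(** * The binomial mode and a lower bound for Hamming spheres *)

Section BinomialMode.
Variables (R : realType) (N : nat) (delta : R).
Hypothesis hdelta : 0 < delta < 1.
Let w := Num.truncn (N%:R * delta).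
Let B j : R := 'C(N, j)%:R * delta ^+ j * (1 - delta) ^+ (N - j).

Let B_ge0 j : 0 <= B j.
Proof. by rewrite /B !mulr_ge0 ?ler0n ?exprn_ge0 //; move: hdelta; lra. Qed.

Let B_step j : j.+1%:R * (1 - delta) * B j.+1 = (N - j)%:R * delta * B j.
Proof.
rewrite /B; have := congr1 (fun x => x%:R : R) (mul_bin_left N j).
rewrite !natrM => e.
have [jN|Nj] := ltnP j N; last first.
  have /eqP -> : (N - j == 0)%N by rewrite subn_eq0.
  by rewrite bin_small ?ltnS// !mul0r mulr0.
have -> : (N - j = (N - j.+1).+1)%N by lia.
rewrite !exprS; move: e; have -> : (N - j = (N - j.+1).+1)%N by lia.
set x := 'C(N, j.+1)%:R; set y := 'C(N, j)%:R => e.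
transitivity (j.+1%:R * x * delta * (1 - delta) * delta ^+ j *
              (1 - delta) ^+ (N - j.+1)); first ring.
by rewrite e; ring.
Qed.

(** By [B_step] the probabilities [B j] rise up to [w] and fall from [w.+1] on, and passing from [w]
    to [w.+1] gains at most a factor $1/(1-\delta)$. Hence each of the [N.+1] terms, which sum to 1,
    is at most [B w / (1 - delta)]. *)
Lemma binomial_mode :
  1 - delta <= N.+1%:R *
    ('C(N, w)%:R * delta ^+ w * (1 - delta) ^+ (N - w)).
Proof.
have [d0 d1] := andP hdelta.
have Nd0 : 0 <= N%:R * delta by rewrite mulr_ge0 // ltW.
have /andP[wle wgt] := truncn_itv Nd0.
rewrite -/w in wle wgt.
have wS : w.+1%:R = w%:R + 1 :> R by rewrite -natr1.
have below j : (j <= w)%N -> B j <= B w.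
  move=> jw; rewrite -(subKn jw); elim: (w - j)%N => [|i IH]; first by rewrite subn0.
  have [wi|iw] := leqP w i; first by have -> : (w - i.+1 = w - i)%N by lia.
  apply: le_trans IH; have -> : (w - i = (w - i.+1).+1)%N by lia.
  set l := (w - i.+1)%N.
  have lw : l.+1%:R <= w%:R :> R by rewrite ler_nat /l; lia.
  have lN : (l <= N)%N.
    rewrite -(ler_nat R); have : N%:R * delta <= N%:R by rewrite ler_piMr // ltW.
    by rewrite -natr1 in lw; lra.
  have l0 : 0 < l.+1%:R :> R by rewrite ltr0n.
  rewrite -(ler_pM2l (_ : 0 < l.+1%:R * (1 - delta))); last by rewrite mulr_gt0; lra.
  rewrite B_step ler_wpM2r // natrB //.
  rewrite -natr1 in lw; rewrite -natr1; nra.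
have above j : (w < j)%N -> B j <= B w.+1.
  move=> wj; rewrite -(subnKC wj); elim: (j - w.+1)%N => [|i IH]; first by rewrite addn0.
  rewrite addnS; apply: le_trans IH; set l := (w.+1 + i)%N.
  have lw : w.+1%:R <= l%:R :> R by rewrite ler_nat /l; lia.
  have l0 : 0 < l.+1%:R :> R by rewrite ltr0n.
  rewrite -(ler_pM2l (_ : 0 < l.+1%:R * (1 - delta))); last by rewrite mulr_gt0; lra.
  rewrite B_step ler_wpM2r //.
  have [lN|Nl] := leqP l N; last first.
    have /eqP -> : (N - l == 0)%N by rewrite subn_eq0 ltnW.
    by rewrite mul0r mulr_ge0 ?ltW //; lra.
  rewrite natrB // -natr1; nra.
(* This uses $(N-w)\delta \le N\delta < w+1$. *)
have top : (1 - delta) * B w.+1 <= B w.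
  have w0 : 0 < w.+1%:R :> R by rewrite ltr0n.
  rewrite -(ler_pM2l w0) mulrA B_step ler_wpM2r //.
  have : (N - w)%:R <= N%:R :> R by rewrite ler_nat leq_subr.
  nra.
have all j : (1 - delta) * B j <= B w.
  have [/below|/above] := leqP j w; have := B_ge0 w; have := B_ge0 j; nra.
have total : \sum_(j < N.+1) (1 - delta) * B j = 1 - delta.
  rewrite -mulr_sumr (_ : \sum_(j < N.+1) B j = 1) ?mulr1//.
  have := exprDn (1 - delta) delta N; rewrite subrK expr1n => ->.
  by apply: eq_bigr => j _; rewrite /B -mulr_natl; ring.
have -> : N.+1%:R * ('C(N, w)%:R * delta ^+ w * (1 - delta) ^+ (N - w)) =
    \sum_(j < N.+1) B w by rewrite sumr_const card_ord mulr_natl.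
by rewrite -[leLHS]total; apply: ler_sum.
Qed.

End BinomialMode.

(** The binomial mass at $w$ is the sphere size times $t^w(1-\delta)^N$. The factor $1-\delta$ on
    the left comes from [binomial_mode], the factor $t$ from rounding $N\delta$ down to $w$. *)
Lemma hamming_sphere_ge (R : realType) (q N : nat) (delta : R) :
  (1 < q)%N -> 0 < delta < 1 - q%:R^-1 ->
  (1 - delta) * tilt q delta * expR (N%:R * (ln q%:R * hq q delta)) <=
  N.+1%:R * ('C(N, Num.truncn (N%:R * delta)) *
             (q - 1) ^ Num.truncn (N%:R * delta))%:R.
Proof.
move=> q1 hd; have t0 := tilt_gt0 q1 hd; have t1 := tilt_lt1 q1 hd.
have qR : 1 < q%:R :> R by rewrite ltr1n.
have d1 : 0 < delta < 1.
  have iq : 0 < q%:R^-1 :> R by rewrite invr_gt0; lra.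
  by move: hd; lra.
have [d0 dl1] := andP d1.
have := binomial_mode N d1; set w := Num.truncn _.
have Nd0 : 0 <= N%:R * delta by rewrite mulr_ge0 // ltW.
have /andP[wle wgt] := truncn_itv Nd0; rewrite -/w in wle wgt.
have wN : (w <= N)%N.
  rewrite -(ler_nat R); have : N%:R * delta <= N%:R by rewrite ler_piMr // ltW.
  lra.
rewrite (hq_tilt q1 hd); set t := tilt q delta in t0 t1 *.
have -> : 'C(N, w)%:R * delta ^+ w * (1 - delta) ^+ (N - w) =
   ('C(N, w) * (q - 1) ^ w)%:R * (t ^+ w * (1 - delta) ^+ N).
  have -> : (1 - delta) ^+ N = (1 - delta) ^+ w * (1 - delta) ^+ (N - w).
    by rewrite -exprD subnKC.
  have -> : delta ^+ w = (t * (q%:R - 1) * (1 - delta)) ^+ w.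
    by congr (_ ^+ _); rewrite /t /tilt; field; apply/andP; split; lra.
  by rewrite natrM natrX natrB ?(ltnW q1) // !exprMn; ring.
set M := (_ * _)%N%:R => mode.
have M0 : 0 <= M by rewrite ler0n.
(* Since $w+1 > N\delta$ and $t<1$, one extra factor $t$ brings $t^w$ below $t^{N\delta}$. *)
have tw : t ^+ w * (1 - delta) ^+ N *
    (t * expR (N%:R * (- delta * ln t - ln (1 - delta)))) <= 1.
  have lnt : ln t < 0 by rewrite ln_lt0 // t0.
  have -> : t ^+ w * (1 - delta) ^+ N *
      (t * expR (N%:R * (- delta * ln t - ln (1 - delta)))) =
     expR (ln t * (w%:R + 1 - N%:R * delta)).
    rewrite -{1 2}(lnK t0) -{1}(@lnK _ (1 - delta)) ?posrE ?subr_gt0 //.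
    by rewrite -!expRM_natr -!expRD; congr expR; ring.
  rewrite expR_le1 // nmulr_rle0 //.
  by rewrite -natr1 in wgt; lra.
apply: (@le_trans _ _ (N.+1%:R * (M * (t ^+ w * (1 - delta) ^+ N)) *
   (t * expR (N%:R * (- delta * ln t - ln (1 - delta)))))).
  by rewrite -[leLHS]mulrA ler_wpM2r // mulr_ge0 ?expR_ge0 // ltW.
by rewrite -[leLHS]mulrA ler_wpM2l ?ler0n // -[leLHS]mulrA ler_piMr.
Qed.

(** * Upper and lower bounds for the expected count at fixed $n$ *)

Section ExpectedCount.
Variables (R : realType) (F : finFieldType) (gT : finGroupType).
Local Notation FG := {ffun gT -> F}.

(* AM-GM over the translates of an information set [S] of size [D]: every
   coordinate is covered by exactly [D] of the [#|gT|] translates. *)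
Lemma ideal_weight_enumerator k (b : {ffun 'I_k -> FG}) (t : R) : 0 < t ->
  exists2 D, #|ideal_of b| = (#|F| ^ D)%N &
    \sum_(c in ideal_of b) expR (ln t * (D%:R / #|gT|%:R)) ^+ galg_wt c <=
    (1 + (#|F|%:R - 1) * t) ^+ D.
Proof.
move=> t0; have [S injS cardI] :=
  information_set (ideal0 b) (@idealD _ _ _ b) (@idealZ _ _ _ b).
exists #|S| => //; set s := expR _.
have m0 : 0 < #|gT|%:R :> R by rewrite ltr0n; apply/card_gt0P; exists 1%g.
have sm : s ^+ #|gT| = t ^+ #|S|.
  rewrite /s -expRM_natr -mulrA divfK ?gt_eqF// expRM_natr lnK //.
have amgm (c : FG) : s ^+ galg_wt c <=
    (\sum_(y : gT) t ^+ ffun_wt (ffun_res S (translate y c))) / #|gT|%:R.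
  have mN0 : (0 < #|gT|)%N by rewrite -(ltr0n R).
  rewrite -(ler_pXn2r mN0) ?nnegrE ?exprn_ge0 ?expR_ge0 //; last first.
    by rewrite divr_ge0 ?sumr_ge0 // => y _; rewrite exprn_ge0 // ltW.
  have [+ _] := @leif_AGM R gT predT (fun y => t ^+ ffun_wt (ffun_res S (translate y c)))
    (fun y _ => exprn_ge0 _ (ltW t0)).
  apply: le_trans.
  by rewrite prodrXr sum_wt_translate exprM -sm -!exprM mulnC.
have tr_inj y : injective (@translate F gT y).
  move=> c d /ffunP cd; apply/ffunP => z; have := cd (z * y^-1)%g.
  by rewrite !ffunE mulgKV.
(* Translating and then restricting to [S] is injective on the ideal, so the sum is at most the one
   over all functions on [S]. *)
have bound y : \sum_(c in ideal_of b) t ^+ ffun_wt (ffun_res S (translate y c)) <=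
    (1 + (#|F|%:R - 1) * t) ^+ #|S|.
  rewrite -[X in _ <= _ ^+ X]card_sig -sum_ffun_wt.
  have inj : {in ideal_of b &, injective (fun c => ffun_res S (translate y c))}.
    by move=> c d cI dI /injS e; apply: (tr_inj y); apply: e; apply: ideal_translate.
  rewrite -(big_imset (fun f => t ^+ ffun_wt f) inj) /=.
  rewrite big_mkcond; apply: ler_sum => f _.
  by case: ifP => // _; rewrite exprn_ge0 // ltW.
apply: le_trans (ler_sum _ (fun c _ => amgm c)) _.
rewrite -mulr_suml exchange_big /= ler_pdivrMr // mulrC.
by rewrite mulr_natl -sumr_const; apply: ler_sum.
Qed.

Variable delta : R.

Definition low_wt n (v : {ffun 'I_n -> FG}) : bool :=
  (1 <= vec_wt v)%N && ((vec_wt v)%:R <= (#|gT| * n)%:R * delta).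

Lemma sum_Nhat k n :
  \sum_(A : {ffun 'I_k * 'I_n -> galg F gT}) (Nhat delta A)%:R =
  \sum_(b : {ffun 'I_k -> FG})
    \sum_(A : {ffun 'I_k * 'I_n -> FG}) (low_wt (vecmat b A))%:R :> R.
Proof.
rewrite exchange_big; apply: eq_bigr => A _.
rewrite /Nhat -sum1_card natr_sum big_mkcond; apply: eq_bigr => b _.
by rewrite inE /low_wt; case: ifP.
Qed.

Hypothesis hdelta : 0 < delta < 1 - #|F|%:R^-1.

(** Chernoff's bound with $s=t^{D/m}$: the enumerator bound to the power $n$, times $s^{-mn\delta}$,
    is $q^{Dn h_q(\delta)}$; division by $|I|^n=q^{Dn}$ leaves $|I|^{-n g_q(\delta)}$. *)
Lemma sum_low_wt_le k n (b : {ffun 'I_k -> FG}) :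
  \sum_(A : {ffun 'I_k * 'I_n -> FG}) (low_wt (vecmat b A))%:R <=
  #|{: {ffun 'I_k * 'I_n -> FG}}|%:R *
    expR (- (n%:R * gq #|F| delta * ln #|ideal_of b|%:R)).
Proof.
have q1 := card_field_gt1 F.
have t0 := tilt_gt0 q1 hdelta; have t1 := tilt_lt1 q1 hdelta.
have tsum := tilt_sum q1 hdelta; have lnh := hq_tilt q1 hdelta.
set t := tilt _ _ in t0 t1 tsum lnh.
have [D cardI enum_le] := ideal_weight_enumerator b t0.
set s := expR _ in enum_le.
have lnt : ln t < 0 by rewrite ln_lt0 // t0.
have qR : 1 < #|F|%:R :> R by rewrite ltr1n.
have d1 : delta < 1.
  have iq : 0 < #|F|%:R^-1 :> R by rewrite invr_gt0; lra.
  by move: hdelta; lra.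
have m0 : 0 < #|gT|%:R :> R by rewrite ltr0n; apply/card_gt0P; exists 1%g.
have I0 : 0 < #|ideal_of b|%:R :> R.
  by rewrite ltr0n; apply/card_gt0P; exists 0; exact: ideal0.
(* [Z] is $s^{-mn\delta}$, so $Z s^{\mathrm{w}(v)} \ge 1$ whenever [v] has low weight. *)
pose Z := expR (- (ln t * D%:R * n%:R * delta)).
have chernoff (v : {ffun 'I_n -> FG}) : (low_wt v)%:R <= Z * s ^+ vec_wt v.
  case: (boolP (low_wt v)) => [/andP[_ wle]|_]; last first.
    by rewrite mulr_ge0 ?exprn_ge0 ?expR_ge0.
  rewrite /Z /s -expRM_natr -expRD -[leLHS]expR0 ler_expR.
  have -> : - (ln t * D%:R * n%:R * delta) + ln t * (D%:R / #|gT|%:R) * (vec_wt v)%:R =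
    (- ln t) * (D%:R / #|gT|%:R) * ((#|gT| * n)%:R * delta - (vec_wt v)%:R).
    by rewrite natrM; field; rewrite gt_eqF.
  rewrite mulr_ge0 ?mulr_ge0 ?invr_ge0 ?ler0n ?subr_ge0 ?oppr_ge0 //; exact: ltW.
apply: le_trans (ler_sum _ (fun A _ => chernoff (vecmat b A))) _.
rewrite -mulr_sumr.
have In0 : 0 < #|ideal_of b|%:R ^+ n :> R by rewrite exprn_gt0.
rewrite -(ler_pM2l In0) mulrCA.
rewrite (sum_vecmat b (fun v => s ^+ vec_wt v)) sum_vec_wt mulrCA [leRHS]mulrCA.
rewrite ler_wpM2l ?ler0n //.
apply: (@le_trans _ _ (Z * ((1 + (#|F|%:R - 1) * t) ^+ D) ^+ n)).
  rewrite ler_wpM2l ?expR_ge0 // lerXn2r ?nnegrE ?sumr_ge0 //.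
    by move=> c _; rewrite exprn_ge0 ?expR_ge0.
  by rewrite exprn_ge0 // tsum invr_ge0; lra.
have lnI : ln #|ideal_of b|%:R = ln #|F|%:R * D%:R :> R.
  by rewrite cardI natrX lnXn ?mulr_natr //; lra.
rewrite -{1}(lnK I0) lnI tsum -(@lnK _ (1 - delta)^-1) ?posrE ?invr_gt0 ?subr_gt0 //.
rewrite lnV ?posrE ?subr_gt0 // -!expRM_natr -!expRD ler_expR /gq.
rewrite le_eqVlt; apply/orP; left; apply/eqP.
have -> : n%:R * (1 - hq #|F| delta) * (ln #|F|%:R * D%:R) =
  n%:R * D%:R * (ln #|F|%:R - ln #|F|%:R * hq #|F| delta) by ring.
by rewrite lnh; ring.
Qed.

(** For the zero ideal [sum_low_wt_le] only gives the bound 1 on the probability; here the condition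
    that the weight be at least 1 removes the term. *)
Lemma sum_low_wt_ideal0 k n (b : {ffun 'I_k -> FG}) : (#|ideal_of b| <= 1)%N ->
  \sum_(A : {ffun 'I_k * 'I_n -> FG}) (low_wt (vecmat b A))%:R = 0 :> R.
Proof.
move=> /card_le1_eqP I1; rewrite big1 // => A _.
rewrite /low_wt /vec_wt big1 // => j _; rewrite vecmatE.
have -> : lcomb b [ffun i => A (i, j)] = 0 by apply: I1; rewrite ?ideal0 ?imset_f.
by apply/eqP; rewrite cards_eq0; apply/eqP/setP => z; rewrite !inE ffunE eqxx.
Qed.

(** Grouping the [b] by their ideal $I$, each nonzero $I$ contributes at most $|I|^{k-n g}$. The
    exponent is nonpositive and $|I|\ge 2$, so this is at most $2^{k-n g}$; the number of all
    subsets of $FG$ bounds the number of ideals. *)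
Lemma ENhat_le (r : R) n :
  (kround r n)%:R <= n%:R * gq #|F| delta ->
  ENhat F gT r delta n <=
  #|{: {set FG}}|%:R *
    expR (((kround r n)%:R - n%:R * gq #|F| delta) * ln 2).
Proof.
rewrite /ENhat; set k := kround r n => kg; rewrite sum_Nhat.
set U := #|_|%:R; have U0 : 0 < U by rewrite ltr0n; apply/card_gt0P; exists 0.
rewrite ler_pdivrMr // (partition_big (@ideal_of F gT k) predT) //=.
set E := expR _; have E0 : 0 <= E by exact: expR_ge0.
have -> : #|{: {set FG}}|%:R * E * U = \sum_(I : {set FG}) E * U.
  by rewrite sumr_const -mulrA mulr_natl.
apply: ler_sum => I _.
have [I1|I1] := leqP #|I| 1.
  rewrite big1 => [|b /eqP bI]; first by rewrite mulr_ge0 // ltW.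
  by rewrite sum_low_wt_ideal0 // bI.
pose X := U * expR (- (n%:R * gq #|F| delta * ln #|I|%:R)).
have X0 : 0 <= X by rewrite mulr_ge0 ?expR_ge0 // ltW.
apply: (@le_trans _ _ (\sum_(b : {ffun 'I_k -> FG} | ideal_of b == I) X)).
  by apply: ler_sum => b /eqP bI; rewrite /X -bI sum_low_wt_le.
rewrite sumr_const.
have cardb : (#|[pred b : {ffun 'I_k -> FG} | ideal_of b == I]| <= #|I| ^ k)%N.
  rewrite -[k in X in (_ <= X)%N]card_ord -card_ffun_on.
  apply/subset_leq_card/fintype.subsetP => b; rewrite inE => /eqP bI.
  by apply/ffun_onP => i; rewrite -bI mem_ideal.
apply: (@le_trans _ _ (X *+ (#|I| ^ k))); first exact: ler_wpMn2l.
have I0 : 0 < #|I|%:R :> R by rewrite ltr0n (ltn_trans _ I1).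
rewrite -[leLHS]mulr_natl natrX -{1}(lnK I0) -expRM_natr /X mulrCA -expRD mulrC.
rewrite ler_wpM2r ?(ltW U0) // /E ler_expR.
have -> : ln #|I|%:R * k%:R + - (n%:R * gq #|F| delta * ln #|I|%:R) =
  (k%:R - n%:R * gq #|F| delta) * ln #|I|%:R by ring.
apply: ler_wnM2l; first by rewrite subr_le0.
by rewrite ler_ln ?posrE // ler_nat.
Qed.

Lemma card_head k (e : FG) :
  (#|{: FG}| ^ k <= #|[set b : {ffun 'I_k.+1 -> FG} | b ord0 == e]|)%N.
Proof.
pose ext (b : {ffun 'I_k -> FG}) : {ffun 'I_k.+1 -> FG} :=
  [ffun i => oapp b e (unlift ord0 i)].
have ext_inj : injective ext.
  move=> b c /ffunP bc; apply/ffunP => i; have := bc (lift ord0 i).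
  by rewrite !ffunE liftK.
rewrite -{1}(card_ord k) -card_ffun -(card_imset predT ext_inj).
apply/subset_leq_card/fintype.subsetP => _ /imsetP[b _ ->].
by rewrite inE ffunE unlift_none.
Qed.

(** Only the [b] whose first entry is the identity of $FG$ are kept, and only products of weight
    exactly [w]. Such [b] make $bA$ uniform on $(FG)^n$. *)
Lemma ENhat_ge (r : R) n (N := (#|gT| * n)%N) (w := Num.truncn (N%:R * delta)) :
  (0 < kround r n)%N -> (0 < w)%N ->
  #|{: FG}|%:R ^+ (kround r n).-1 * ('C(N, w) * (#|F| - 1) ^ w)%:R <=
  ENhat F gT r delta n * #|{: FG}|%:R ^+ n.
Proof.
rewrite /ENhat; case: (kround r n) => // k _ w0.
rewrite sum_Nhat; set U := (X in _ / X).
have U0 : 0 < U by rewrite ltr0n; apply/card_gt0P; exists 0.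
have Q0 : 0 < #|{: FG}|%:R :> R by rewrite ltr0n; apply/card_gt0P; exists 0.
have Nd0 : 0 <= N%:R * delta.
  by rewrite mulr_ge0 ?ler0n //; move: hdelta => /andP[/ltW].
pose e : FG := [ffun z => (z == 1%g)%:R].
have unif (b : {ffun 'I_k.+1 -> FG}) : b ord0 = e ->
    U * ('C(N, w) * (#|F| - 1) ^ w)%:R <= #|{: FG}|%:R ^+ n *
     (\sum_(A : {ffun 'I_k.+1 * 'I_n -> FG}) (low_wt (vecmat b A))%:R).
  move=> be; have := sum_vecmat b (fun v : {ffun 'I_n -> FG} => (low_wt v)%:R : R).
  rewrite (idealT be) cardsT => ->; rewrite ler_wpM2l ?(ltW U0) //.
  rewrite -card_vec_wt -sum1_card natr_sum.
  rewrite [leLHS]big_mkcond [leRHS]big_mkcond; apply: ler_sum => v _.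
  rewrite inE; have -> : v \in ffun_on [set: FG].
    by apply/ffun_onP => i; rewrite finset.in_setT.
  by case: eqP => // vw; rewrite /low_wt vw w0 truncn_le Nd0.
rewrite mulrAC ler_pdivlMr // [leRHS]mulrC mulr_sumr.
apply: (@le_trans _ _ (\sum_(b : {ffun 'I_k.+1 -> FG} | b ord0 == e)
    U * ('C(N, w) * (#|F| - 1) ^ w)%:R)).
  rewrite sumr_const -[leRHS]mulr_natl -[leLHS]mulrA [_ * U]mulrC.
  rewrite ler_wpM2r ?mulr_ge0 ?(ltW U0) //.
  rewrite -natrX ler_nat; apply: leq_trans (card_head k e) _.
  by rewrite cardsE.
rewrite [leRHS](bigID (fun b : {ffun 'I_k.+1 -> FG} => b ord0 == e)) /=.
apply: ler_wpDr; last by apply: ler_sum => b /eqP /unif.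
by apply: sumr_ge0 => b _; rewrite mulr_ge0 ?exprn_ge0 ?sumr_ge0 // ltW.
Qed.

End ExpectedCount.

(** * Absorbing constants and linear factors into exponentials *)

Section Asymptotics.
Local Open Scope classical_set_scope.
Variable R : realType.

Lemma near_expR_le (M a : R) : 0 < a ->
  \forall n \near \oo, M * expR (- (a * n%:R)) <= expR (- (a / 2 * n%:R)).
Proof.
move=> a0; near=> n.
have : M <= expR (a / 2 * n%:R).
  apply: le_trans (expR_ge1Dx _).
  have : 2 * M / a <= n%:R by near: n; exact: nbhs_infty_ger.
  by rewrite ler_pdivrMr //; lra.
move=> MM; have -> : - (a * n%:R) = - (a / 2 * n%:R) - a / 2 * n%:R by field.
rewrite expRD mulrCA ler_piMr ?expR_ge0 // expRN.
by rewrite ler_pdivrMr ?expR_gt0 // mul1r.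
Unshelve. all: by end_near. Qed.

Lemma near_expR_ge (m : nat) (K a : R) : 0 < K -> 0 < a ->
  \forall n \near \oo, (m * n).+1%:R * expR (a / 2 * n%:R) <=
    K * expR (a * n%:R).
Proof.
move=> K0 a0; near=> n.
have n1 : 1 <= n%:R :> R by rewrite ler1n; near: n; exact: nbhs_infty_gt.
(* Chosen so that $(m+1)n \le K(an/2)^2/2$, where $(an/2)^2/2$ is the quadratic Taylor term of
   $e^{an/2}$. *)
have nbig : (m.+1)%:R / (K * a ^+ 2 / 8) <= n%:R by near: n; exact: nbhs_infty_ger.
have -> : a * n%:R = a / 2 * n%:R + a / 2 * n%:R by field.
rewrite expRD mulrA ler_wpM2r ?expR_ge0 //.
have an0 : 0 <= a / 2 * n%:R by rewrite mulr_ge0 ?ler0n //; lra.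
have h := expR_ge1Dxn 1 an0; apply: le_trans (ler_wpM2l (ltW K0) h).
move: nbig; rewrite ler_pdivrMr; last by rewrite !mulr_gt0 ?exprn_gt0.
rewrite -natr1 => nbig; rewrite -natr1 natrM.
have mn : m%:R * n%:R + 1 <= (m%:R + 1) * n%:R :> R by lra.
apply: le_trans mn _.
apply: (@le_trans _ _ (n%:R * (K * a ^+ 2 / 8) * n%:R)).
  by rewrite ler_wpM2r.
rewrite (_ : 2`! = 2)%N //.
have -> : n%:R * (K * a ^+ 2 / 8) * n%:R = K * ((a / 2 * n%:R) ^+ 2 / 2) by field.
by rewrite ler_pM2l // lerDr.
Unshelve. all: by end_near. Qed.

Lemma cvg0_expR_bound (f : nat -> R) (c : R) : 0 < c -> (forall n, 0 <= f n) ->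
  (\forall n \near \oo, f n <= expR (- (c * n%:R))) -> f n @[n --> \oo] --> 0.
Proof.
move=> c0 f0 fle; apply/cvgrPdist_le => e e0; near=> n.
rewrite sub0r normrN ger0_norm //.
apply: (@le_trans _ _ (expR (- (c * n%:R)))); first by near: n.
rewrite expRN -[leRHS]invrK lef_pV2 ?posrE ?invr_gt0 ?expR_gt0 //.
apply: le_trans (expR_ge1Dx _).
have : e^-1 / c <= n%:R by near: n; exact: nbhs_infty_ger.
by rewrite ler_pdivrMr //; lra.
Unshelve. all: by end_near. Qed.

Lemma cvg_expR_natr (c : R) : 0 < c -> expR (c * n%:R) @[n --> \oo] --> +oo.
Proof.
move=> c0; apply/cvgryPge => e; near=> n.
apply: le_trans (expR_ge1Dx _).
have : e / c <= n%:R by near: n; exact: nbhs_infty_ger.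
by rewrite ler_pdivrMr //; lra.
Unshelve. all: by end_near. Qed.

End Asymptotics.

(** * The two regimes of the expected count *)

Local Open Scope classical_set_scope.

Theorem theorem4p1 (R : realType) (F : finFieldType) (gT : finGroupType)
  (r delta : R) :
  abelian (finset.setTfor gT) ->
  0 < r < 1 ->
  0 < delta < 1 - (#|F|%:R)^-1 ->
  (r < gq #|F| delta ->
     (ENhat F gT r delta n @[n --> \oo] --> 0) /\
     exists2 c : R, 0 < c &
       \forall n \near \oo, ENhat F gT r delta n <= expR (- (c * n%:R)))
  /\
  (gq #|F| delta < r ->
     (ENhat F gT r delta n @[n --> \oo] --> +oo) /\
     exists2 c : R, 0 < c &
       \forall n \near \oo, expR (c * n%:R) <= ENhat F gT r delta n).
Proof.
move=> _ /andP[r0 r1] hdelta; set g := gq _ _.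
have q1 := card_field_gt1 F.
have lnq : 0 < ln #|F|%:R :> R by rewrite ln_gt0 // ltr1n.
have ln2 : 0 < ln 2 :> R by rewrite ln_gt0 // ltr1n.
have kP n : (kround r n)%:R <= r * n%:R + 2^-1 < (kround r n)%:R + 1.
  have h0 : 0 <= r * n%:R + 2^-1 by rewrite addr_ge0 ?mulr_ge0 ?invr_ge0 // ltW.
  by have := truncn_itv h0; rewrite -[(Num.truncn _).+1%:R]natr1.
split=> hr.
- pose a := (g - r) * ln 2; have a0 : 0 < a by rewrite mulr_gt0 ?subr_gt0.
  suff [c c0 up] : exists2 c : R, 0 < c &
      \forall n \near \oo, ENhat F gT r delta n <= expR (- (c * n%:R)).
    split; last by exists c.
    apply: cvg0_expR_bound c0 _ up => n.
    by rewrite /ENhat divr_ge0 ?sumr_ge0.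
  exists (a / 2); first by rewrite divr_gt0.
  (* The factor $e^{\ln 2/2}$ pays for rounding, as $k \le rn+1/2$. *)
  have Mexp := near_expR_le (#|{: {set {ffun gT -> F}}}|%:R * expR (2^-1 * ln 2)) a0.
  near=> n.
  have /andP[kle _] := kP n.
  (* From here on $rn+1/2 \le ng$, which gives the hypothesis of [ENhat_le]. *)
  have nbig : 2^-1 / (g - r) <= n%:R by near: n; exact: nbhs_infty_ger.
  rewrite ler_pdivrMr ?subr_gt0 // in nbig.
  have kg : (kround r n)%:R <= n%:R * g by lra.
  apply: le_trans (ENhat_le gT hdelta kg) _.
  apply: (le_trans _ (_ : _ * expR (- (a * n%:R)) <= _)); last by near: n; exact: Mexp.
  rewrite -mulrA ler_wpM2l ?ler0n // -expRD ler_expR -/g.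
  have -> : 2^-1 * ln 2 + - (a * n%:R) = (2^-1 - (g - r) * n%:R) * ln 2.
    by rewrite /a; ring.
  by rewrite ler_wpM2r ?(ltW ln2) //; lra.
- pose m : R := #|gT|%:R.
  have m0 : 0 < m by rewrite ltr0n; apply/card_gt0P; exists 1%g.
  pose a := m * ln #|F|%:R * (r - g).
  have a0 : 0 < a by rewrite !mulr_gt0 ?subr_gt0.
  suff [c c0 low] : exists2 c : R, 0 < c &
      \forall n \near \oo, expR (c * n%:R) <= ENhat F gT r delta n.
    split; last by exists c.
    exact: ger_cvgy low (cvg_expR_natr c0).
  exists (a / 2); first by rewrite divr_gt0.
  have [d0 d1] := andP hdelta.
  have dl1 : delta < 1.
    have iq : 0 < #|F|%:R^-1 :> R by rewrite invr_gt0 ltr0n ltnW.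
    by lra.
  pose T := (1 - delta) * tilt #|F| delta.
  have T0 : 0 < T by apply: mulr_gt0 (tilt_gt0 q1 hdelta); rewrite subr_gt0.
  (* The lower bound has exponent $k-1-ng$ in base $q^m$, and $k > rn-1/2$; together they lose
     $3/2$. *)
  pose K := T * expR (- (3 / 2 * m * ln #|F|%:R)).
  have K0 : 0 < K by rewrite mulr_gt0 // expR_gt0.
  have Kexp := near_expR_ge #|gT| K0 a0.
  near=> n.
  have /andP[_ kgt] := kP n.
  (* The thresholds [n1] and [n2] make $k$ and the radius $\lfloor mn\delta\rfloor$ positive. *)
  have n1 : 1 / r <= n%:R by near: n; exact: nbhs_infty_ger.
  rewrite ler_pdivrMr // in n1.
  have n2 : 1 / (m * delta) <= n%:R by near: n; exact: nbhs_infty_ger.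
  rewrite ler_pdivrMr ?mulr_gt0 // in n2.
  have k0 : (0 < kround r n)%N by rewrite -(ltr0n R); lra.
  have w0 : (0 < Num.truncn ((#|gT| * n)%N%:R * delta))%N.
    by rewrite truncn_gt0 natrM -/m; lra.
  have ge := ENhat_ge hdelta k0 w0.
  have sphere := hamming_sphere_ge (#|gT| * n) q1 hdelta.
  set M : R := (_ * _ ^ _)%N%:R in ge sphere.
  pose Q : R := #|{: {ffun gT -> F}}|%:R.
  rewrite -/Q in ge.
  have N0 : 0 < (#|gT| * n).+1%:R :> R by rewrite ltr0n.
  have Q0 : 0 < Q by rewrite ltr0n; apply/card_gt0P; exists 0.
  have lnQ : ln Q = ln #|F|%:R * m.
    by rewrite /Q card_ffun natrX lnXn ?mulr_natr // ltr0n ltnW.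
  rewrite -(ler_pM2l N0).
  apply: (@le_trans _ _ (K * expR (a * n%:R))); first by near: n; exact: Kexp.
  rewrite -(ler_pM2r (exprn_gt0 n Q0)) -[leRHS]mulrA.
  apply: le_trans (ler_wpM2l (ltW N0) ge).
  rewrite mulrCA; apply: le_trans (ler_wpM2l (exprn_ge0 _ (ltW Q0)) sphere).
  rewrite -/T [leRHS]mulrCA /K -!(mulrA T) ler_wpM2l ?(ltW T0) // -mulrA.
  rewrite -{1 2}(lnK Q0) lnQ -!expRM_natr -!expRD ler_expR.
  have -> : (kround r n).-1%:R = (kround r n)%:R - 1 :> R.
    by rewrite -subn1 natrB.
  rewrite natrM -/m /a.
  have -> : m * n%:R * (ln #|F|%:R * hq #|F| delta) =
     m * ln #|F|%:R * (n%:R * (1 - g)) by rewrite /g /gq; ring.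
  have -> : - (3 / 2 * m * ln #|F|%:R) + (m * ln #|F|%:R * (r - g) * n%:R +
    ln #|F|%:R * m * n%:R) = m * ln #|F|%:R * (n%:R * (1 + r - g) - 3 / 2) by ring.
  have -> : ln #|F|%:R * m * ((kround r n)%:R - 1) +
    m * ln #|F|%:R * (n%:R * (1 - g)) =
    m * ln #|F|%:R * (n%:R * (1 - g) + (kround r n)%:R - 1) by ring.
  rewrite ler_wpM2l ?mulr_ge0 ?(ltW m0) ?(ltW lnq) //.
  lra.
Unshelve. all: by end_near. Qed.
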